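(* All étale groupoids (as objects) and all equivalence classes of couple morphisms (as morphisms) form a category, with composition $$[\varphi_2,\psi_2;K_2]\cdot[\varphi_1,\psi_1;K_1]:=[\varphi_1\circ\widetilde{\varphi_2},\ \psi_2\circ\widetilde{\psi_1};\ K_1\times_{G_2}K_2]$$ for couple morphisms $[\varphi_1,\psi_1;K_1]\colon G_1\to G_2$ and $[\varphi_2,\psi_2;K_2]\colon G_2\to G_3$, and with identity morphism $[\mathrm{id}_G,\mathrm{id}_G;G]$ for each étale groupoid $G$.
   Context: A groupoid $G$ has unit space $G^{(0)}\subset G$, domain and range maps $d,r\colon G\to G^{(0)}$; $g'g$ is defined iff $d(g')=r(g)$. $G_u:=d^{-1}(u)$ for $u\in G^{(0)}$. A topological groupoid has a topology making multiplication and inversion continuous ($G^{(0)}$ has the subspace topology); it is étale if $d\colon G\to G^{(0)}$ is a local homeomorphism (every point has an open neighbourhood mapped homeomorphically onto an open subset of $G^{(0)}$). No Hausdorff or local compactness assumption is made. For a groupoid homomorphism $\varphi\colon G\to H$ let $\varphi^{(0)}\colon G^{(0)}\to H^{(0)}$ and $\varphi_u\colon G_u\to H_{\varphi(u)}$ ($u\in G^{(0)}$) be its restrictions. $\varphi$ is fibrewise bijective if $\varphi_u$ is bijective for all $u\in G^{(0)}$. For étale groupoids $G,H$, a couple morphism $(\varphi,\psi;K)\colon G\to H$ consists of an étale groupoid $K$, a continuous fibrewise bijective groupoid homomorphism $\varphi\colon K\to G$, and a continuous groupoid homomorphism $\psi\colon K\to H$ with $\psi^{(0)}$ open and injective. Couple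 morphisms $(\varphi_i,\psi_i;K_i)\colon G\to H$, $i=1,2$, are equivalent if there is a groupoid isomorphism $\iota\colon K_1\to K_2$ that is a homeomorphism with $\varphi_2\circ\iota=\varphi_1$, $\psi_2\circ\iota=\psi_1$. $[\varphi,\psi;K]$ denotes the equivalence class. For couple morphisms $(\varphi_i,\psi_i;K_i)\colon G_i\to G_{i+1}$ ($i=1,2$), the pull-back groupoid is $K_1\times_{G_2}K_2:=\{(k_1,k_2)\in K_1\times K_2:\psi_1(k_1)=\varphi_2(k_2)\}$ with component-wise structure and the topology induced from the product; $\widetilde{\varphi_2}(k_1,k_2):=k_1$ and $\widetilde{\psi_1}(k_1,k_2):=k_2$. *)

(* Defs.v *)
From mathcomp Require Import all_boot all_order.
From mathcomp Require Import all_classical.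
From mathcomp Require Import topology.

Set Implicit Arguments.
Unset Strict Implicit.
Unset Printing Implicit Defensive.

Local Open Scope classical_set_scope.

(* A set [A : set X], used as a type, is the subtype of its elements; for a
   topological space [X] this subtype carries the subspace topology. *)

Definition open_map (X Y : topologicalType) (f : X -> Y) : Prop :=
  forall U : set X, open U -> open (f @` U).

Definition homeomorphism (X Y : topologicalType) (f : X -> Y) : Prop :=
  exists g : Y -> X, [/\ cancel f g, cancel g f, continuous f & continuous g].

Definition local_homeomorphism (X Y : topologicalType) (f : X -> Y) : Prop :=
  forall x : X, exists (U : set X) (V : set Y) (h : U -> V),
    [/\ open U, U x, open V, homeomorphism h
      & forall u : U, set_val (h u) = f (set_val u)].

(* The arrows carry a topology, but no compatibility between the topology and
   the groupoid structure is required before [topological_groupoid].  The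
   product [g' g] is [mul c], where [c] is a proof of [dom g' = rng g]. *)
Record groupoid := Groupoid {
  arrow :> topologicalType;
  unit_space : set arrow;
  dom : arrow -> unit_space;
  rng : arrow -> unit_space;
  mul : forall g' g : arrow, dom g' = rng g -> arrow;
  inv : arrow -> arrow;
  dom_unit : forall u : unit_space, dom (set_val u) = u;
  rng_unit : forall u : unit_space, rng (set_val u) = u;
  dom_mul : forall (g' g : arrow) (c : dom g' = rng g), dom (mul c) = dom g;
  rng_mul : forall (g' g : arrow) (c : dom g' = rng g), rng (mul c) = rng g';
  mulA : forall (g3 g2 g1 : arrow) (c32 : dom g3 = rng g2)
      (c21 : dom g2 = rng g1) (cl : dom (mul c32) = rng g1)
      (cr : dom g3 = rng (mul c21)), mul cl = mul cr;
  mulu : forall (g : arrow) (c : dom g = rng (set_val (dom g))), mul c = g;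
  umul : forall (g : arrow) (c : dom (set_val (rng g)) = rng g), mul c = g;
  dom_inv : forall g : arrow, dom (inv g) = rng g;
  rng_inv : forall g : arrow, rng (inv g) = dom g;
  mulV : forall (g : arrow) (c : dom g = rng (inv g)),
    mul c = set_val (rng g);
  Vmul : forall (g : arrow) (c : dom (inv g) = rng g),
    mul c = set_val (dom g)
}.

Arguments unit_space : clear implicits.

Definition fibre (G : groupoid) (u : unit_space G) : set G :=
  [set g | dom g = u].

Definition composable (G : groupoid) : set (G * G) :=
  [set p | dom p.1 = rng p.2].

Arguments composable : clear implicits.

Definition mul_map (G : groupoid) (p : composable G) : G := mul (set_valP p).

Definition topological_groupoid (G : groupoid) : Prop :=
  continuous (@mul_map G) /\ continuous (@inv G).

Definition etale (G : groupoid) : Prop :=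
  topological_groupoid G /\ local_homeomorphism (@dom G).

Record etale_groupoid := EtaleGroupoid {
  etale_gpd :> groupoid;
  etaleP : etale etale_gpd
}.

Record groupoid_hom (G H : groupoid) := GroupoidHom {
  hom_fun :> G -> H;
  hom_dom : forall g : G, set_val (dom (hom_fun g)) = hom_fun (set_val (dom g));
  hom_rng : forall g : G, set_val (rng (hom_fun g)) = hom_fun (set_val (rng g));
  hom_mul : forall (g' g : G) (c : dom g' = rng g)
      (c' : dom (hom_fun g') = rng (hom_fun g)), hom_fun (mul c) = mul c'
}.

Lemma hom_unit (G H : groupoid) (f : groupoid_hom G H) (u : unit_space G) :
  unit_space H (f (set_val u)).
Proof. by rewrite -{1}(dom_unit u) -hom_dom; exact: set_valP. Qed.

(* The restriction of a homomorphism to the unit spaces. *)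
Definition unit_map (G H : groupoid) (f : groupoid_hom G H) (u : unit_space G) :
    unit_space H :=
  SigSub (mem_set (hom_unit f u)).

Definition fibrewise_bijective (G H : groupoid) (f : groupoid_hom G H) : Prop :=
  forall u : unit_space G, set_bij (fibre u) (fibre (unit_map f u)) f.

Lemma hom_domE (G H : groupoid) (f : groupoid_hom G H) (g : G) :
  dom (f g) = unit_map f (dom g).
Proof. by apply: val_inj; exact: hom_dom. Qed.

Lemma hom_rngE (G H : groupoid) (f : groupoid_hom G H) (g : G) :
  rng (f g) = unit_map f (rng g).
Proof. by apply: val_inj; exact: hom_rng. Qed.

Lemma hom_composable (G H : groupoid) (f : groupoid_hom G H) (g' g : G) :
  dom g' = rng g -> dom (f g') = rng (f g).
Proof. by move=> c; rewrite hom_domE hom_rngE c. Qed.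

Definition hom_id (G : groupoid) : groupoid_hom G G.
Proof.
by exists (fun g => g) => // g' g c c'; rewrite (Prop_irrelevance c c').
Defined.

Definition hom_comp (G H K : groupoid) (f : groupoid_hom H K) (e : groupoid_hom G H) :
    groupoid_hom G K.
Proof.
exists (f \o e) => [g|g|g' g c c'] /=.
- by rewrite hom_dom hom_dom.
- by rewrite hom_rng hom_rng.
- by rewrite (hom_mul c (hom_composable e c)) (hom_mul _ c').
Defined.

Section pullback.
Variables (K1 K2 G : groupoid).
Variables (psi : groupoid_hom K1 G) (phi : groupoid_hom K2 G).

Definition pullback_arrow : set (K1 * K2) := [set p | psi p.1 = phi p.2].

Definition pullback_unit : set pullback_arrow :=
  [set p | unit_space K1 (set_val p).1 /\ unit_space K2 (set_val p).2].

Definition pb_arrow (k1 : K1) (k2 : K2) (e : psi k1 = phi k2) :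
    pullback_arrow :=
  SigSub (mem_set (e : pullback_arrow (k1, k2))).

Lemma pb_arrow_eq (p q : pullback_arrow) :
  (set_val p).1 = (set_val q).1 -> (set_val p).2 = (set_val q).2 -> p = q.
Proof.
move=> e1 e2; apply: val_inj => /=; move: e1 e2; rewrite /set_val /=.
by case: (val p) (val q) => [a b] [a' b'] /= -> ->.
Qed.

Lemma pb_unit_proof (u1 : unit_space K1) (u2 : unit_space K2)
    (e : psi (set_val u1) = phi (set_val u2)) :
  pullback_unit (pb_arrow e).
Proof. by split; exact: set_valP. Qed.

Definition pb_unit (u1 : unit_space K1) (u2 : unit_space K2)
    (e : psi (set_val u1) = phi (set_val u2)) : pullback_unit :=
  SigSub (mem_set (pb_unit_proof e)).

Lemma pb_unit_eq (p q : pullback_unit) :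
  (set_val (set_val p)).1 = (set_val (set_val q)).1 ->
  (set_val (set_val p)).2 = (set_val (set_val q)).2 -> p = q.
Proof. by move=> e1 e2; apply: val_inj; exact: pb_arrow_eq. Qed.

Lemma pb_dom_proof (p : pullback_arrow) :
  psi (set_val (dom (set_val p).1)) = phi (set_val (dom (set_val p).2)).
Proof. by rewrite -!hom_dom (set_valP p). Qed.

Lemma pb_rng_proof (p : pullback_arrow) :
  psi (set_val (rng (set_val p).1)) = phi (set_val (rng (set_val p).2)).
Proof. by rewrite -!hom_rng (set_valP p). Qed.

Definition pb_dom (p : pullback_arrow) : pullback_unit :=
  pb_unit (pb_dom_proof p).

Definition pb_rng (p : pullback_arrow) : pullback_unit :=
  pb_unit (pb_rng_proof p).

Lemma pb_composable1 (p' p : pullback_arrow) :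
  pb_dom p' = pb_rng p -> dom (set_val p').1 = rng (set_val p).1.
Proof.
by move=> /(congr1 (fun q : pullback_unit => (set_val (set_val q)).1)) /val_inj.
Qed.

Lemma pb_composable2 (p' p : pullback_arrow) :
  pb_dom p' = pb_rng p -> dom (set_val p').2 = rng (set_val p).2.
Proof.
by move=> /(congr1 (fun q : pullback_unit => (set_val (set_val q)).2)) /val_inj.
Qed.

Lemma pb_mul_proof (p' p : pullback_arrow) (c : pb_dom p' = pb_rng p) :
  psi (mul (pb_composable1 c)) = phi (mul (pb_composable2 c)).
Proof.
rewrite (hom_mul _ (hom_composable psi (pb_composable1 c))).
rewrite (hom_mul _ (hom_composable phi (pb_composable2 c))).
move: (hom_composable _ _) (hom_composable _ _).
by rewrite (set_valP p') (set_valP p) => a b; rewrite (Prop_irrelevance a b).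
Qed.

Definition pb_mul (p' p : pullback_arrow) (c : pb_dom p' = pb_rng p) :
    pullback_arrow :=
  pb_arrow (pb_mul_proof c).

Lemma hom_inv (A B : groupoid) (f : groupoid_hom A B) (g : A) :
  f (inv g) = inv (f g).
Proof.
have mul_eq (x y z t : B) (c : dom x = rng y) (c' : dom z = rng t) :
  x = z -> y = t -> mul c = mul c'.
  move=> xz yt; move: c c'; rewrite xz yt => c c'.
  by rewrite (Prop_irrelevance c c').
have c1 : dom g = rng (inv g) by rewrite rng_inv.
have c2 : dom (inv (f g)) = rng (f g) by rewrite dom_inv.
have c3 := hom_composable f c1.
have cl : dom (mul c2) = rng (f (inv g)) by rewrite dom_mul.
have cr : dom (inv (f g)) = rng (mul c3) by rewrite rng_mul.
have A3 := mulA cl cr.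
have du (x : B) : dom (set_val (rng x)) = rng x by rewrite dom_unit.
have ud (x : B) : dom x = rng (set_val (dom x)) by rewrite rng_unit.
rewrite -[LHS](umul (du _)) -[RHS](mulu (ud _)).
transitivity (mul cl).
  apply: mul_eq => //; rewrite Vmul hom_rngE rng_inv.
  by rewrite hom_domE.
rewrite A3; apply: mul_eq => //.
by rewrite -(hom_mul c1 c3) mulV dom_inv hom_rng.
Qed.

Lemma pb_inv_proof (p : pullback_arrow) :
  psi (inv (set_val p).1) = phi (inv (set_val p).2).
Proof. by rewrite !hom_inv (set_valP p). Qed.

Definition pb_inv (p : pullback_arrow) : pullback_arrow :=
  pb_arrow (pb_inv_proof p).

(* The topology on the type [pullback_arrow] is induced from the product. *)
Definition pullback : groupoid.
Proof.
apply: (@Groupoid pullback_arrow pullback_unit pb_dom pb_rng pb_mul pb_inv).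
- move=> u; have [u1 u2] := set_valP u; apply: pb_unit_eq => /=.
  + exact: (congr1 set_val (dom_unit (SigSub (mem_set u1)))).
  + exact: (congr1 set_val (dom_unit (SigSub (mem_set u2)))).
- move=> u; have [u1 u2] := set_valP u; apply: pb_unit_eq => /=.
  + exact: (congr1 set_val (rng_unit (SigSub (mem_set u1)))).
  + exact: (congr1 set_val (rng_unit (SigSub (mem_set u2)))).
- by move=> g' g c; apply: pb_unit_eq; rewrite /= dom_mul.
- by move=> g' g c; apply: pb_unit_eq; rewrite /= rng_mul.
- by move=> g3 g2 g1 c32 c21 cl cr; apply: pb_arrow_eq; exact: mulA.
- by move=> g c; apply: pb_arrow_eq; exact: mulu.
- by move=> g c; apply: pb_arrow_eq; exact: umul.
- by move=> g; apply: pb_unit_eq; rewrite /= dom_inv.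
- by move=> g; apply: pb_unit_eq; rewrite /= rng_inv.
- by move=> g c; apply: pb_arrow_eq; exact: mulV.
- by move=> g c; apply: pb_arrow_eq; exact: Vmul.
Defined.

Definition pullback_fst : groupoid_hom pullback K1.
Proof.
exists (fun p : pullback => (set_val (p : pullback_arrow)).1) => //.
by move=> g' g c c' /=; rewrite (Prop_irrelevance c' (pb_composable1 c)).
Defined.

Definition pullback_snd : groupoid_hom pullback K2.
Proof.
exists (fun p : pullback => (set_val (p : pullback_arrow)).2) => //.
by move=> g' g c c' /=; rewrite (Prop_irrelevance c' (pb_composable2 c)).
Defined.

End pullback.

(* A triple (phi, psi; K) of homomorphisms G <- K -> H, on which the
   conditions on couple morphisms are not yet imposed. *)
Record span (G H : groupoid) := Span {
  apex : groupoid;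
  span_left : groupoid_hom apex G;
  span_right : groupoid_hom apex H
}.

Definition is_couple_morphism (G H : groupoid) (s : span G H) : Prop :=
  [/\ etale (apex s),
      continuous (span_left s) /\ fibrewise_bijective (span_left s),
      continuous (span_right s),
      open_map (unit_map (span_right s))
    & injective (unit_map (span_right s))].

Record couple_morphism (G H : etale_groupoid) := CoupleMorphism {
  couple_span :> span G H;
  couple_morphismP : is_couple_morphism couple_span
}.

Definition groupoid_isomorphism (G H : groupoid) (f : groupoid_hom G H) :
    Prop :=
  exists f' : groupoid_hom H G, cancel f f' /\ cancel f' f.

Definition couple_equiv (G H : etale_groupoid) (c1 c2 : couple_morphism G H) :
    Prop :=
  exists iota : groupoid_hom (apex c1) (apex c2),
    [/\ groupoid_isomorphism iota, homeomorphism iota,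
        span_left c2 \o iota =1 span_left c1
      & span_right c2 \o iota =1 span_right c1].

Lemma couple_equiv_refl (G H : etale_groupoid) (c : couple_morphism G H) :
  couple_equiv c c.
Proof.
exists (hom_id _); split=> //; first by exists (hom_id _).
by exists idfun; split=> // x; exact: cvg_id.
Qed.

Lemma couple_equiv_sym (G H : etale_groupoid) (c1 c2 : couple_morphism G H) :
  couple_equiv c1 c2 -> couple_equiv c2 c1.
Proof.
case=> i [[j [ij ji]] [k [ik ki ci ck]] el er].
have jk : hom_fun j = k by apply/funext => x; rewrite -[in LHS](ki x) ij.
exists j; split.
- by exists i.
- by exists i; split=> //; rewrite jk.
- by move=> x /=; rewrite -el /= ji.
- by move=> x /=; rewrite -er /= ji.
Qed.

Lemma couple_equiv_trans (G H : etale_groupoid)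
    (c1 c2 c3 : couple_morphism G H) :
  couple_equiv c1 c2 -> couple_equiv c2 c3 -> couple_equiv c1 c3.
Proof.
case=> i [[j [ij ji]] [k [ik ki ci ck]] el er].
case=> i' [[j' [ij' ji']] [k' [ik' ki' ci' ck']] el' er'].
exists (hom_comp i' i); split.
- by exists (hom_comp j j'); split=> x /=; rewrite ?ij' ?ji ?ij ?ji'.
- exists (k \o k'); split=> [x|x|x|x] /=.
  + by rewrite ik' ik.
  + by rewrite ki ki'.
  + exact: (continuous_comp (ci x) (ci' (i x))).
  + exact: (continuous_comp (ck' x) (ck (k' x))).
- by move=> x /=; rewrite -el /= -el'.
- by move=> x /=; rewrite -er /= -er'.
Qed.

(* Couple morphisms form a type too large for the argument of [set], hence the
   plain predicates below. *)
Definition equiv_class (G H : etale_groupoid) (c : couple_morphism G H) :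
    couple_morphism G H -> Prop :=
  fun c' => couple_equiv c c'.

Definition couple_class (G H : etale_groupoid) : Type :=
  {E : couple_morphism G H -> Prop | exists c, E = equiv_class c}.

Definition class_of (G H : etale_groupoid) (c : couple_morphism G H) :
    couple_class G H :=
  exist _ (equiv_class c) (ex_intro _ c erefl).

Lemma class_of_eq (G H : etale_groupoid) (c1 c2 : couple_morphism G H) :
  class_of c1 = class_of c2 <-> couple_equiv c1 c2.
Proof.
split=> [/(congr1 (@proj1_sig _ _)) /= e|e12].
  have : equiv_class c2 c2 by exact: couple_equiv_refl.
  by rewrite -e.
apply: eq_exist; apply/funext => c; apply/propext; split.
  exact/couple_equiv_trans/couple_equiv_sym.
exact: couple_equiv_trans.
Qed.

Definition id_span (G : groupoid) : span G G := Span (hom_id G) (hom_id G).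

Definition comp_span (G1 G2 G3 : groupoid) (s2 : span G2 G3)
    (s1 : span G1 G2) : span G1 G3 :=
  Span (hom_comp (span_left s1) (pullback_fst (span_right s1) (span_left s2)))
       (hom_comp (span_right s2) (pullback_snd (span_right s1) (span_left s2))).

Record category_on (Ob : Type) (Mor : Ob -> Ob -> Type) := CategoryOn {
  cat_comp : forall A B C : Ob, Mor B C -> Mor A B -> Mor A C;
  cat_id : forall A : Ob, Mor A A;
  cat_compA : forall (A B C D : Ob) (h : Mor C D) (g : Mor B C) (f : Mor A B),
    cat_comp h (cat_comp g f) = cat_comp (cat_comp h g) f;
  cat_idl : forall (A B : Ob) (f : Mor A B), cat_comp (cat_id B) f = f;
  cat_idr : forall (A B : Ob) (f : Mor A B), cat_comp f (cat_id A) = f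
}.

(* Main.v *)
From mathcomp Require Import all_boot.
From mathcomp Require Import all_classical.
From mathcomp Require Import topology.
Require Import Defs.

(** The apex of a composite is the fibre product [P] of [psi : K1 -> G]
    and [phi : K2 -> G], and the theorem amounts to three facts about it.

    First, [P] is again etale.  The difficulty is that its domain map is open:
    a unit [(u1, u2)] of [P] near [(dom k1, dom k2)] lifts to arrows [x1], [x2]
    near [k1], [k2], and nothing says a priori that [psi x1 = phi x2].  But
    these two arrows of [G] are close to [psi k1 = phi k2] and have the same
    domain, so they agree because [dom] is injective near [psi k1]
    ([open_map_pullback_dom]).  The argument only uses that a local
    homeomorphism is a continuous, open, locally injective map
    ([local_homeomorphismP]), which avoids handling local inverses.

    Secondly, the properties of the legs pass to the composite: fibrewise
    bijectivity of [phi] is inherited by the projection to [K1], and openness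
    and injectivity of [psi] on units by the projection to [K2]
    ([is_couple_morphism_comp]).

    Thirdly, [P] has the universal property of a fibre product
    ([pullback_pair], [continuous_pullback_pair]), so compatibility with
    equivalence, the unit laws and associativity up to equivalence all follow by
    writing down two mutually inverse continuous homomorphisms
    ([couple_equiv_comp], [couple_equiv_idl], [couple_equiv_idr],
    [couple_equivA]).  Passing to equivalence classes turns these into the
    category axioms. *)

Set Implicit Arguments.
Unset Strict Implicit.
Unset Printing Implicit Defensive.

Local Open Scope classical_set_scope.

(** * Subspaces, open maps and local homeomorphisms *)

Lemma nbhs_subtypeP (X : topologicalType) (A : set X) (x : A) (U : set A) :
  nbhs x U <-> exists2 V, nbhs (set_val x) V & set_val @^-1` V `<=` U.
Proof.
split=> [xU|[V xV VU]].
  rewrite nbhsE in xU; have [_ [[V oV <-] xV] VU] := xU.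
  by exists V => //; exact: open_nbhs_nbhs.
by apply: filterS VU _; exact: (@initial_continuous A X set_val x V xV).
Qed.

Lemma continuous_subtype (X Y : topologicalType) (A : set Y) (f : X -> A) :
  continuous (set_val \o f) -> continuous f.
Proof.
move=> cf x U /nbhs_subtypeP[V fxV VU].
have : nbhs x ((set_val \o f) @^-1` V) by exact: cf.
by apply: filterS => y; exact: VU.
Qed.

Lemma continuous_set_val (X : topologicalType) (A : set X) :
  continuous (set_val : A -> X).
Proof. exact: initial_continuous. Qed.

Lemma continuousT_comp (X Y Z : topologicalType) (f : X -> Y) (g : Y -> Z) :
  continuous f -> continuous g -> continuous (g \o f).
Proof. by move=> cf cg x; apply: continuous_comp; [exact: cf|exact: cg]. Qed.

Lemma continuous_pairing (X Y Z : topologicalType) (f : X -> Y) (g : X -> Z) :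
  continuous f -> continuous g -> continuous (fun x => (f x, g x)).
Proof. by move=> cf cg x; apply: cvg_pair; [exact: cf|exact: cg]. Qed.

Lemma continuous_fst (X Y : topologicalType) : continuous (@fst X Y).
Proof. by move=> x; exact: cvg_fst. Qed.

Lemma continuous_snd (X Y : topologicalType) : continuous (@snd X Y).
Proof. by move=> x; exact: cvg_snd. Qed.

(** Openness becomes a statement about one point at a time, which suits maps
    whose image is only controlled near a given point. *)
Lemma open_mapP (X Y : topologicalType) (f : X -> Y) :
  open_map f <-> forall x U, nbhs x U -> nbhs (f x) (f @` U).
Proof.
split=> [of_ x U|nf U oU].
  rewrite nbhsE => -[V [oV xV] VU].
  apply: filterS (image_subset f VU) _.
  by apply: open_nbhs_nbhs; split; [exact: of_|exists x].
rewrite openE => _ [x Ux <-]; apply: nf.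
exact: open_nbhs_nbhs.
Qed.

Definition locally_injective (X : topologicalType) (Y : Type) (f : X -> Y) :
    Prop :=
  forall x : X, exists2 U : set X, nbhs x U & set_inj U f.

(** An open map that is injective on an open set [U] is automatically a
    homeomorphism from [U] onto its image, so the local inverses in the
    definition can be traded for openness. *)
Lemma local_homeomorphismP (X Y : topologicalType) (f : X -> Y) :
  local_homeomorphism f <->
  [/\ continuous f, open_map f & locally_injective f].
Proof.
split=> [lhf|[cf of_ jf] x].
- split.
  + move=> x W fxW; have [U [V [h [oU Ux oV [g [hK gK ch cg]] hE]]]] := lhf x.
    pose u : U := SigSub (mem_set Ux).
    have : nbhs u ((set_val \o h) @^-1` W).
      apply: (continuousT_comp ch (@continuous_set_val _ V)).
      by rewrite /= hE.
    move=> /nbhs_subtypeP[V' xV' V'W].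
    have xU : nbhs x U by exact: open_nbhs_nbhs.
    apply: filterS (filterI xU xV') => y [Uy V'y] /=.
    by have := V'W (SigSub (mem_set Uy)) V'y; rewrite /= hE.
  + apply/open_mapP => x W xW.
    have [U [V [h [oU Ux oV [g [hK gK ch cg]] hE]]]] := lhf x.
    pose u : U := SigSub (mem_set Ux).
    have : nbhs (h u) ((set_val \o g) @^-1` W).
      apply: (continuousT_comp cg (@continuous_set_val _ U)).
      by rewrite /= hK.
    move=> /nbhs_subtypeP[V' xV' V'W].
    have fxV : nbhs (f x) V.
      by apply: open_nbhs_nbhs; split=> //; rewrite -(hE u); exact: set_valP.
    move: xV'; rewrite hE => xV'.
    apply: filterS (filterI fxV xV') => y [Vy V'y] /=.
    pose v : V := SigSub (mem_set Vy).
    by exists (set_val (g v)); [exact: (V'W v V'y)|rewrite -hE gK].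
  + move=> x; have [U [V [h [oU Ux oV [g [hK gK ch cg]] hE]]]] := lhf x.
    exists U; first exact: open_nbhs_nbhs.
    move=> a b Ua Ub fab.
    have /val_inj/(can_inj hK) : set_val (h (SigSub Ua)) = set_val (h (SigSub Ub)).
      by rewrite !hE.
    by move=> /(congr1 set_val).
- have [U0] := jf x; rewrite nbhsE => -[U [oU Ux] UU0] jU0.
  have jU (a b : X) : U a -> U b -> f a = f b -> a = b.
    by move=> /UU0/mem_set Ua /UU0/mem_set Ub; exact: jU0.
  have hP (u : U) : (f @` U) (f (set_val u)).
    by exists (set_val u) => //; exact: set_valP.
  pose h (u : U) : f @` U := SigSub (mem_set (hP u)).
  (* The inverse chooses a preimage in [U]; injectivity makes it unique. *)
  pose w (v : f @` U) : {a | U a & f a = set_val v} := cid2 (set_valP v).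
  pose g (v : f @` U) : U := SigSub (mem_set (s2valP (w v))).
  have fg (v : f @` U) : f (set_val (g v)) = set_val v.
    exact: (s2valP' (w v)).
  exists U, (f @` U), h; split=> //; first exact: of_.
  exists g; split.
  + move=> u; apply: val_inj; apply: jU; [exact: set_valP..|].
    exact: (fg (h u)).
  + by move=> v; apply: val_inj; exact: (fg v).
  + apply: continuous_subtype.
    exact: (continuousT_comp (@continuous_set_val _ U) cf).
  + move=> v W /nbhs_subtypeP[W' gvW' W'W].
    apply/nbhs_subtypeP; exists (f @` (W' `&` U)).
      rewrite -fg; move/open_mapP: of_; apply; apply: filterI => //.
      by apply: open_nbhs_nbhs; split=> //; exact: set_valP.
    move=> v' [a [W'a Ua] fa]; apply: W'W => /=.
    suff -> : set_val (g v') = a by [].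
    by apply: jU => //; [exact: set_valP|rewrite fg].
Qed.

(** * Pullback groupoids *)

Lemma continuous_unit_map (G H : groupoid) (f : groupoid_hom G H) :
  continuous f -> continuous (unit_map f).
Proof.
move=> cf; apply: continuous_subtype.
exact: (continuousT_comp (@continuous_set_val _ _) cf).
Qed.

(** Viewing multiplication as one map on composable pairs lets a homomorphism
    commute with it ([hom_mul_map]) without any proof of composability to
    transport. *)
Definition composable_map (G H : groupoid) (f : groupoid_hom G H)
    (c : composable G) : composable H :=
  SigSub (mem_set (hom_composable f (set_valP c) :
    composable H (f (set_val c).1, f (set_val c).2))).

Lemma continuous_composable_map (G H : groupoid) (f : groupoid_hom G H) :
  continuous f -> continuous (composable_map f).
Proof.
move=> cf; apply: continuous_subtype.
apply: (continuous_pairing (f := fun c => f (set_val c).1)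
  (g := fun c => f (set_val c).2)).
- apply: (continuousT_comp (f := fun c => (set_val c).1)) cf.
  exact: (continuousT_comp (@continuous_set_val _ _) (@continuous_fst _ _)).
- apply: (continuousT_comp (f := fun c => (set_val c).2)) cf.
  exact: (continuousT_comp (@continuous_set_val _ _) (@continuous_snd _ _)).
Qed.

Lemma hom_mul_map (G H : groupoid) (f : groupoid_hom G H) (c : composable G) :
  f (mul_map c) = mul_map (composable_map f c).
Proof. exact: hom_mul. Qed.

Section Pullback.
Context {K1 K2 G : groupoid}.
Context (psi : groupoid_hom K1 G) (phi : groupoid_hom K2 G).
Local Notation P := (pullback psi phi).
Local Notation pr1 := (pullback_fst psi phi).
Local Notation pr2 := (pullback_snd psi phi).

Lemma pullback_square (p : P) : psi (pr1 p) = phi (pr2 p).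
Proof. exact: (set_valP p). Qed.

Lemma continuous_pullback_fst : continuous pr1.
Proof.
exact: (continuousT_comp (@continuous_set_val _ _) (@continuous_fst _ _)).
Qed.

Lemma continuous_pullback_snd : continuous pr2.
Proof.
exact: (continuousT_comp (@continuous_set_val _ _) (@continuous_snd _ _)).
Qed.

Lemma continuous_into_pullback (X : topologicalType) (f : X -> P) :
  continuous (pr1 \o f) -> continuous (pr2 \o f) -> continuous f.
Proof.
move=> c1 c2; apply: continuous_subtype.
rewrite (_ : set_val \o f = fun x => (pr1 (f x), pr2 (f x))).
  exact: continuous_pairing.
by apply/funext => x /=; rewrite -surjective_pairing.
Qed.

Lemma nbhs_pullback (p : P) (W : set P) : nbhs p W ->
  exists U1 U2, [/\ nbhs (pr1 p) U1, nbhs (pr2 p) U2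
    & forall q : P, U1 (pr1 q) -> U2 (pr2 q) -> W q].
Proof.
move=> /nbhs_subtypeP[V [[U1 U2] /= [pU1 pU2] UV] VW].
by exists U1, U2; split=> // q q1 q2; apply: VW; exact: UV.
Qed.

(** The unit space of the pullback is itself a pullback, of the unit spaces: a
    unit is a pair of units, and boxes of neighbourhoods taken in the two unit
    spaces form a basis. *)
Lemma nbhs_pullback_unit (w : unit_space P) (W : set (unit_space P)) :
  nbhs w W ->
  exists U1 U2, [/\ nbhs (unit_map pr1 w) U1, nbhs (unit_map pr2 w) U2
    & forall v, U1 (unit_map pr1 v) -> U2 (unit_map pr2 v) -> W v].
Proof.
move=> /nbhs_subtypeP[V /nbhs_pullback[U1 [U2 [wU1 wU2 UV]]] VW].
exists (set_val @^-1` U1), (set_val @^-1` U2); split.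
- by apply/nbhs_subtypeP; exists U1.
- by apply/nbhs_subtypeP; exists U2.
- by move=> v v1 v2; apply: VW; exact: UV.
Qed.

Lemma pullback_unit_square (w : unit_space P) :
  unit_map psi (unit_map pr1 w) = unit_map phi (unit_map pr2 w).
Proof. by apply: val_inj; exact: pullback_square. Qed.

Lemma pullback_unit_eq (w w' : unit_space P) :
  unit_map pr1 w = unit_map pr1 w' -> unit_map pr2 w = unit_map pr2 w' ->
  w = w'.
Proof.
by move=> /(congr1 set_val) e1 /(congr1 set_val) e2; exact: pb_unit_eq.
Qed.

Lemma pullback_unit_ex (u1 : unit_space K1) (u2 : unit_space K2) :
  unit_map psi u1 = unit_map phi u2 ->
  exists w : unit_space P, unit_map pr1 w = u1 /\ unit_map pr2 w = u2.
Proof.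
move=> /(congr1 set_val) e; exists (pb_unit (e : psi _ = phi _)).
by split; exact: val_inj.
Qed.

(** The projections are homomorphisms, so each component of a product or an
    inverse in the pullback is the product or inverse of the components. *)
Lemma topological_groupoid_pullback :
  topological_groupoid K1 -> topological_groupoid K2 -> topological_groupoid P.
Proof.
move=> [cm1 ci1] [cm2 ci2]; split; apply: continuous_into_pullback.
- rewrite (_ : _ \o _ = @mul_map K1 \o composable_map pr1).
    apply: continuousT_comp cm1.
    exact/continuous_composable_map/continuous_pullback_fst.
  by apply/funext => c; exact: (hom_mul_map pr1).
- rewrite (_ : _ \o _ = @mul_map K2 \o composable_map pr2).
    apply: continuousT_comp cm2.
    exact/continuous_composable_map/continuous_pullback_snd.
  by apply/funext => c; exact: (hom_mul_map pr2).
- exact: (continuousT_comp continuous_pullback_fst ci1).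
- exact: (continuousT_comp continuous_pullback_snd ci2).
Qed.

(** Units of the pullback lift to pairs of arrows, but these need not have the
    same image in [G].  Keeping both images in a neighbourhood [U] of the common
    value on which [dom] is injective forces them to coincide, since their
    domains do. *)
Lemma open_map_pullback_dom :
  continuous psi -> continuous phi -> locally_injective (@dom G) ->
  open_map (@dom K1) -> open_map (@dom K2) -> open_map (@dom P).
Proof.
move=> cpsi cphi jG o1 o2; apply/open_mapP => p W.
move=> /nbhs_pullback[U1 [U2 [pU1 pU2 UW]]].
have [U gU jU] := jG (psi (pr1 p)).
pose V1 := U1 `&` psi @^-1` U; pose V2 := U2 `&` phi @^-1` U.
have pV1 : nbhs (pr1 p) V1 by apply: filterI => //; exact: cpsi.
have pV2 : nbhs (pr2 p) V2.
  by apply: filterI => //; apply: cphi; rewrite -pullback_square.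
have n1 : nbhs (dom p) (unit_map pr1 @^-1` (@dom K1 @` V1)).
  apply: (continuous_unit_map continuous_pullback_fst).
  by rewrite -hom_domE; move/open_mapP: o1; exact.
have n2 : nbhs (dom p) (unit_map pr2 @^-1` (@dom K2 @` V2)).
  apply: (continuous_unit_map continuous_pullback_snd).
  by rewrite -hom_domE; move/open_mapP: o2; exact.
apply: filterS (filterI n1 n2) => w [[k1 [U1k1 Uk1] e1] [k2 [U2k2 Uk2] e2]].
have e : psi k1 = phi k2.
  apply: jU; [exact: mem_set..|].
  by rewrite !hom_domE e1 e2 pullback_unit_square.
exists (pb_arrow e : P); first exact: UW.
by apply: pullback_unit_eq; rewrite -hom_domE.
Qed.

Lemma locally_injective_pullback_dom :
  locally_injective (@dom K1) -> locally_injective (@dom K2) ->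
  locally_injective (@dom P).
Proof.
move=> j1 j2 p.
have [U1 pU1 jU1] := j1 (pr1 p); have [U2 pU2 jU2] := j2 (pr2 p).
exists (pr1 @^-1` U1 `&` pr2 @^-1` U2).
  apply: filterI; first exact: continuous_pullback_fst.
  exact: continuous_pullback_snd.
move=> a b /set_mem[a1 a2] /set_mem[b1 b2] ab; apply: pb_arrow_eq.
- apply: jU1; [exact: mem_set..|].
  by rewrite -[LHS]/(dom (pr1 a)) -[RHS]/(dom (pr1 b)) !hom_domE ab.
- apply: jU2; [exact: mem_set..|].
  by rewrite -[LHS]/(dom (pr2 a)) -[RHS]/(dom (pr2 b)) !hom_domE ab.
Qed.

Lemma etale_pullback : continuous psi -> continuous phi ->
  etale K1 -> etale K2 -> etale G -> etale P.
Proof.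
move=> cpsi cphi [t1 /local_homeomorphismP[c1 o1 j1]].
move=> [t2 /local_homeomorphismP[c2 o2 j2]] [_ /local_homeomorphismP[_ _ jG]].
split; first exact: topological_groupoid_pullback.
apply/local_homeomorphismP; split.
- apply: continuous_subtype; apply: continuous_into_pullback.
  + apply: (continuousT_comp (f := @dom K1 \o pr1)) (@continuous_set_val _ _).
    exact: (continuousT_comp continuous_pullback_fst).
  + apply: (continuousT_comp (f := @dom K2 \o pr2)) (@continuous_set_val _ _).
    exact: (continuousT_comp continuous_pullback_snd).
- exact: open_map_pullback_dom.
- exact: locally_injective_pullback_dom.
Qed.

(** An arrow [k1] over [unit_map pr1 w] is completed to an arrow over [w] by the
    only arrow [k2] over [unit_map pr2 w] with [phi k2 = psi k1]. *)
Lemma fibrewise_bijective_pullback_fst :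
  fibrewise_bijective phi -> fibrewise_bijective pr1.
Proof.
move=> bphi w; have [_ jphi sphi] := bphi (unit_map pr2 w); split.
- by move=> p <-; exact: (hom_domE pr1).
- move=> p q /set_mem pw /set_mem qw e1; apply: pb_arrow_eq => //.
  have pr2w (p' : P) : dom p' = w -> pr2 p' \in fibre (unit_map pr2 w).
    by move=> <-; apply: mem_set; exact: (hom_domE pr2).
  apply: jphi; [exact: pr2w..|].
  rewrite -[LHS](pullback_square p) -[RHS](pullback_square q).
  exact: (congr1 psi).
- move=> k1 /= dk1.
  have [k2 /= dk2 e] : (phi @` fibre (unit_map pr2 w)) (psi k1).
    by apply: sphi; rewrite /fibre /= hom_domE dk1 pullback_unit_square.
  exists (pb_arrow (esym e) : P) => //.
  by apply: pullback_unit_eq; rewrite -hom_domE.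
Qed.

Lemma injective_pullback_snd_unit :
  injective (unit_map psi) -> injective (unit_map pr2).
Proof.
move=> jpsi w w' e; apply: pullback_unit_eq => //.
by apply: jpsi; rewrite !pullback_unit_square e.
Qed.

(** On units, the image of a box [U1 x U2] under the second projection is
    [U2] intersected with the preimage under [phi] of the image of [U1] under
    [psi], a neighbourhood because [psi] is open on units. *)
Lemma open_map_pullback_snd_unit :
  continuous phi -> open_map (unit_map psi) -> open_map (unit_map pr2).
Proof.
move=> cphi /open_mapP opsi; apply/open_mapP => w W.
move=> /nbhs_pullback_unit[U1 [U2 [wU1 wU2 UW]]].
have : nbhs (unit_map pr2 w) (unit_map phi @^-1` (unit_map psi @` U1)).
  apply: (continuous_unit_map cphi).
  by rewrite -pullback_unit_square; exact: opsi.
move=> /(filterI wU2); apply: filterS => u2 [U2u2 [u1 U1u1 e]].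
have [v [v1 v2]] := pullback_unit_ex e.
by exists v => //; apply: UW; rewrite ?v1 ?v2.
Qed.

(** The universal property of the pullback; every homomorphism into a composite
    of couple morphisms below is obtained from it. *)
Definition pullback_pair (L : groupoid) (a : groupoid_hom L K1)
    (b : groupoid_hom L K2) (e : psi \o a =1 phi \o b) : groupoid_hom L P.
Proof.
exists (fun l => pb_arrow (e l) : P).
- by move=> l; apply: pb_arrow_eq; exact: hom_dom.
- by move=> l; apply: pb_arrow_eq; exact: hom_rng.
- by move=> g' g c c'; apply: pb_arrow_eq; exact: hom_mul.
Defined.

Lemma continuous_pullback_pair (L : groupoid) (a : groupoid_hom L K1)
    (b : groupoid_hom L K2) (e : psi \o a =1 phi \o b) :
  continuous a -> continuous b -> continuous (pullback_pair e).
Proof. by move=> ca cb; exact: continuous_into_pullback. Qed.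

End Pullback.

(** * Couple morphisms and their composites *)

Lemma continuous_id (X : topologicalType) : continuous (@id X).
Proof. by move=> x; exact: cvg_id. Qed.

Lemma unit_map_id (G : groupoid) : unit_map (hom_id G) = id.
Proof. by apply/funext => u; exact: val_inj. Qed.

Lemma unit_map_comp (G H K : groupoid) (f : groupoid_hom H K)
    (e : groupoid_hom G H) :
  unit_map (hom_comp f e) = unit_map f \o unit_map e.
Proof. by apply/funext => u; exact: val_inj. Qed.

Lemma open_map_comp (X Y Z : topologicalType) (f : X -> Y) (g : Y -> Z) :
  open_map f -> open_map g -> open_map (g \o f).
Proof. by move=> of_ og U /of_/og; rewrite image_comp. Qed.

Lemma fibrewise_bijective_comp (G H K : groupoid) (f : groupoid_hom H K)
    (e : groupoid_hom G H) :
  fibrewise_bijective f -> fibrewise_bijective e ->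
  fibrewise_bijective (hom_comp f e).
Proof.
move=> bf be u; rewrite unit_map_comp.
exact: (set_bij_comp (be u) (bf (unit_map e u))).
Qed.

Lemma is_couple_morphism_id (G : etale_groupoid) :
  is_couple_morphism (id_span G).
Proof.
split; [exact: etaleP| |exact: continuous_id| |].
- split; first exact: continuous_id.
  by move=> u; rewrite unit_map_id; split=> //= g gu; exists g.
- by rewrite /= unit_map_id => U; rewrite image_id.
- by rewrite /= unit_map_id.
Qed.

Lemma is_couple_morphism_comp (G1 G2 G3 : etale_groupoid) (s1 : span G1 G2)
    (s2 : span G2 G3) :
  is_couple_morphism s1 -> is_couple_morphism s2 ->
  is_couple_morphism (comp_span s2 s1).
Proof.
move=> [e1 [cl1 b1] cr1 o1 j1] [e2 [cl2 b2] cr2 o2 j2]; split.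
- exact: etale_pullback (etaleP G2).
- split; first exact: (continuousT_comp (@continuous_pullback_fst _ _ _ _ _) cl1).
  exact/fibrewise_bijective_comp/fibrewise_bijective_pullback_fst.
- exact: (continuousT_comp (@continuous_pullback_snd _ _ _ _ _) cr2).
- rewrite /= unit_map_comp; apply: open_map_comp o2.
  exact: open_map_pullback_snd_unit.
- rewrite /= unit_map_comp; apply: inj_comp => //.
  exact: injective_pullback_snd_unit.
Qed.

Definition id_couple (G : etale_groupoid) : couple_morphism G G :=
  CoupleMorphism (is_couple_morphism_id G).

Definition comp_couple (G1 G2 G3 : etale_groupoid)
    (c2 : couple_morphism G2 G3) (c1 : couple_morphism G1 G2) :
    couple_morphism G1 G3 :=
  CoupleMorphism
    (is_couple_morphism_comp (couple_morphismP c1) (couple_morphismP c2)).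

Lemma continuous_span_left (G H : etale_groupoid) (c : couple_morphism G H) :
  continuous (span_left c).
Proof. by have [_ []] := couple_morphismP c. Qed.

Lemma continuous_span_right (G H : etale_groupoid) (c : couple_morphism G H) :
  continuous (span_right c).
Proof. by have [] := couple_morphismP c. Qed.

(** * Composition up to equivalence *)

Lemma couple_equiv_of_inverse (G H : etale_groupoid)
    (c1 c2 : couple_morphism G H) (i : groupoid_hom (apex c1) (apex c2))
    (j : groupoid_hom (apex c2) (apex c1)) :
  cancel i j -> cancel j i -> continuous i -> continuous j ->
  span_left c2 \o i =1 span_left c1 -> span_right c2 \o i =1 span_right c1 ->
  couple_equiv c1 c2.
Proof.
by move=> ij ji ci cj el er; exists i; split=> //; exists j.
Qed.

(** The inverse of an equivalence as a homomorphism and its inverse as a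
    homeomorphism are the same map, hence a continuous homomorphism, and it is
    compatible with the legs as well. *)
Lemma couple_equivP (G H : etale_groupoid) (c1 c2 : couple_morphism G H) :
  couple_equiv c1 c2 ->
  exists (i : groupoid_hom (apex c1) (apex c2))
         (j : groupoid_hom (apex c2) (apex c1)),
    [/\ cancel i j, cancel j i, continuous i, continuous j &
       [/\ span_left c2 \o i =1 span_left c1,
        span_right c2 \o i =1 span_right c1,
        span_left c1 \o j =1 span_left c2 &
        span_right c1 \o j =1 span_right c2]].
Proof.
move=> [i [[j [ij ji]] [k [ik ki ci ck]] el er]]; exists i, j.
have jk : hom_fun j = k by apply/funext => x; rewrite -[in LHS](ki x) ij.
split=> //; first by rewrite jk.
by split=> // x /=; rewrite -?el -?er /= ji.
Qed.

Lemma couple_equiv_comp (G1 G2 G3 : etale_groupoid)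
    (c1 c1' : couple_morphism G1 G2) (c2 c2' : couple_morphism G2 G3) :
  couple_equiv c1 c1' -> couple_equiv c2 c2' ->
  couple_equiv (comp_couple c2 c1) (comp_couple c2' c1').
Proof.
move=> /couple_equivP[i1 [j1 [ij1 ji1 ci1 cj1 [il1 ir1 jl1 jr1]]]].
move=> /couple_equivP[i2 [j2 [ij2 ji2 ci2 cj2 [il2 ir2 jl2 jr2]]]].
pose pr1 := pullback_fst (span_right c1) (span_left c2).
pose pr2 := pullback_snd (span_right c1) (span_left c2).
pose pr1' := pullback_fst (span_right c1') (span_left c2').
pose pr2' := pullback_snd (span_right c1') (span_left c2').
have ei : span_right c1' \o hom_comp i1 pr1 =1 span_left c2' \o hom_comp i2 pr2.
  move=> p; have /= -> := ir1 (pr1 p); have /= -> := il2 (pr2 p).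
  exact: pullback_square.
have ej : span_right c1 \o hom_comp j1 pr1' =1 span_left c2 \o hom_comp j2 pr2'.
  move=> p; have /= -> := jr1 (pr1' p); have /= -> := jl2 (pr2' p).
  exact: pullback_square.
apply: (@couple_equiv_of_inverse _ _ (comp_couple c2 c1) (comp_couple c2' c1')
  (pullback_pair ei) (pullback_pair ej)).
- by move=> p; apply: pb_arrow_eq; [exact: ij1|exact: ij2].
- by move=> p; apply: pb_arrow_eq; [exact: ji1|exact: ji2].
- apply: continuous_pullback_pair; apply: continuousT_comp => //.
    exact: continuous_pullback_fst.
  exact: continuous_pullback_snd.
- apply: continuous_pullback_pair; apply: continuousT_comp => //.
    exact: continuous_pullback_fst.
  exact: continuous_pullback_snd.
- by move=> p; exact: il1.
- by move=> p; exact: ir2.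
Qed.

(** An arrow of the pullback along the identity is a pair [(k, psi k)]. *)
Lemma couple_equiv_idl (G H : etale_groupoid) (c : couple_morphism G H) :
  couple_equiv (comp_couple (id_couple H) c) c.
Proof.
pose pr1 := pullback_fst (span_right c) (hom_id H).
have e : span_right c \o hom_id (apex c) =1 hom_id H \o span_right c by [].
apply: (@couple_equiv_of_inverse _ _ (comp_couple (id_couple H) c) c
  pr1 (pullback_pair e)) => //.
- by move=> p; apply: pb_arrow_eq => //; exact: pullback_square.
- exact: continuous_pullback_fst.
- apply: continuous_pullback_pair; first exact: continuous_id.
  exact: continuous_span_right.
- by move=> p; exact: pullback_square.
Qed.

Lemma couple_equiv_idr (G H : etale_groupoid) (c : couple_morphism G H) :
  couple_equiv (comp_couple c (id_couple G)) c.
Proof.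
pose pr2 := pullback_snd (hom_id G) (span_left c).
have e : hom_id G \o span_left c =1 span_left c \o hom_id (apex c) by [].
apply: (@couple_equiv_of_inverse _ _ (comp_couple c (id_couple G)) c
  pr2 (pullback_pair e)) => //.
- move=> p; apply: pb_arrow_eq => //; exact: esym (pullback_square p).
- exact: continuous_pullback_snd.
- apply: continuous_pullback_pair; last exact: continuous_id.
  exact: continuous_span_left.
- by move=> p; exact: esym (pullback_square p).
Qed.

(** Both nestings encode the triples with [psi1 k1 = phi2 k2] and
    [psi2 k2 = phi3 k3]: the inner pair carries one condition, the outer pair the
    other, and re-bracketing exchanges their roles. *)
Lemma couple_equivA (G1 G2 G3 G4 : etale_groupoid)
    (c1 : couple_morphism G1 G2) (c2 : couple_morphism G2 G3)
    (c3 : couple_morphism G3 G4) :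
  couple_equiv (comp_couple c3 (comp_couple c2 c1))
               (comp_couple (comp_couple c3 c2) c1).
Proof.
pose psi1 := span_right c1; pose phi2 := span_left c2.
pose psi2 := span_right c2; pose phi3 := span_left c3.
(* In the names below [f] and [s] are first and second projections, [l] and [r]
   refer to the left- and right-nested pullbacks. *)
pose s12 := pullback_snd psi1 phi2; pose f12 := pullback_fst psi1 phi2.
pose s23 := pullback_snd psi2 phi3; pose f23 := pullback_fst psi2 phi3.
pose fl := pullback_fst (hom_comp psi2 s12) phi3.
pose sl := pullback_snd (hom_comp psi2 s12) phi3.
pose fr := pullback_fst psi1 (hom_comp phi2 f23).
pose sr := pullback_snd psi1 (hom_comp phi2 f23).
have e23 : psi2 \o hom_comp s12 fl =1 phi3 \o sl.
  by move=> p; exact: (pullback_square p).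
have ei : psi1 \o hom_comp f12 fl =1 hom_comp phi2 f23 \o pullback_pair e23.
  by move=> p; exact: (pullback_square (fl p)).
have e12 : psi1 \o fr =1 phi2 \o hom_comp f23 sr.
  by move=> p; exact: (pullback_square p).
have ej : hom_comp psi2 s12 \o pullback_pair e12 =1 phi3 \o hom_comp s23 sr.
  by move=> p; exact: (pullback_square (sr p)).
have cf12 : continuous f12 by exact: continuous_pullback_fst.
have cs12 : continuous s12 by exact: continuous_pullback_snd.
have cf23 : continuous f23 by exact: continuous_pullback_fst.
have cs23 : continuous s23 by exact: continuous_pullback_snd.
have cfl : continuous fl by exact: continuous_pullback_fst.
have csl : continuous sl by exact: continuous_pullback_snd.
have cfr : continuous fr by exact: continuous_pullback_fst.
have csr : continuous sr by exact: continuous_pullback_snd.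
have cf12fl : continuous (hom_comp f12 fl) by exact: (continuousT_comp cfl).
have cs12fl : continuous (hom_comp s12 fl) by exact: (continuousT_comp cfl).
have cf23sr : continuous (hom_comp f23 sr) by exact: (continuousT_comp csr).
have cs23sr : continuous (hom_comp s23 sr) by exact: (continuousT_comp csr).
apply: (@couple_equiv_of_inverse _ _ (comp_couple c3 (comp_couple c2 c1))
  (comp_couple (comp_couple c3 c2) c1) (pullback_pair ei) (pullback_pair ej)).
- move=> p; apply: pb_arrow_eq; last exact: erefl.
  by apply: pb_arrow_eq; exact: erefl.
- move=> p; apply: pb_arrow_eq; first exact: erefl.
  by apply: pb_arrow_eq; exact: erefl.
- exact: (continuous_pullback_pair (e := ei) cf12fl
    (continuous_pullback_pair (e := e23) cs12fl csl)).
- exact: (continuous_pullback_pair (e := ej)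
    (continuous_pullback_pair (e := e12) cfr cf23sr) cs23sr).
- by move=> p; exact: erefl.
- by move=> p; exact: erefl.
Qed.

(** * The category of equivalence classes *)

Definition class_repr (G H : etale_groupoid) (E : couple_class G H) :
    couple_morphism G H :=
  projT1 (cid (proj2_sig E)).

Lemma class_reprK (G H : etale_groupoid) (E : couple_class G H) :
  class_of (class_repr E) = E.
Proof. by case: E => E pE; apply: eq_exist; exact: esym (projT2 (cid pE)). Qed.

Lemma class_repr_of (G H : etale_groupoid) (c : couple_morphism G H) :
  couple_equiv (class_repr (class_of c)) c.
Proof. by apply/class_of_eq; rewrite class_reprK. Qed.

Definition comp_class (G1 G2 G3 : etale_groupoid) (E2 : couple_class G2 G3)
    (E1 : couple_class G1 G2) : couple_class G1 G3 :=
  class_of (comp_couple (class_repr E2) (class_repr E1)).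

(** Composition of classes is computed on chosen representatives; it does not
    depend on the choice because equivalences compose. *)
Lemma comp_class_of (G1 G2 G3 : etale_groupoid) (c2 : couple_morphism G2 G3)
    (c1 : couple_morphism G1 G2) :
  comp_class (class_of c2) (class_of c1) = class_of (comp_couple c2 c1).
Proof. by apply/class_of_eq; apply: couple_equiv_comp; exact: class_repr_of. Qed.

Lemma comp_classA (A B C D : etale_groupoid) (h : couple_class C D)
    (g : couple_class B C) (f : couple_class A B) :
  comp_class h (comp_class g f) = comp_class (comp_class h g) f.
Proof.
rewrite -(class_reprK h) -(class_reprK g) -(class_reprK f) !comp_class_of.
by apply/class_of_eq; exact: couple_equivA.
Qed.

Lemma comp_class_idl (A B : etale_groupoid) (f : couple_class A B) :
  comp_class (class_of (id_couple B)) f = f.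
Proof.
rewrite -(class_reprK f) comp_class_of; apply/class_of_eq.
exact: couple_equiv_idl.
Qed.

Lemma comp_class_idr (A B : etale_groupoid) (f : couple_class A B) :
  comp_class f (class_of (id_couple A)) = f.
Proof.
rewrite -(class_reprK f) comp_class_of; apply/class_of_eq.
exact: couple_equiv_idr.
Qed.

Theorem theorem4p34 :
  exists C : category_on couple_class,
    (forall G : etale_groupoid,
       exists i : couple_morphism G G,
         couple_span i = id_span G /\ cat_id C G = class_of i) /\
    (forall (G1 G2 G3 : etale_groupoid)
            (c1 : couple_morphism G1 G2) (c2 : couple_morphism G2 G3),
       exists c : couple_morphism G1 G3,
         couple_span c = comp_span c2 c1 /\
         cat_comp C (class_of c2) (class_of c1) = class_of c).
Proof.
exists (CategoryOn comp_classA comp_class_idl comp_class_idr); split.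
- by move=> G; exists (id_couple G).
- move=> G1 G2 G3 c1 c2; exists (comp_couple c2 c1); split=> //.
  exact: comp_class_of.
Qed.
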